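(* Let $R$, $R'$, $U$ be TRSs over $\Sigma$ and $T\subseteq\mathcal{T}(\Sigma,\emptyset)$ such that $U$ is terminating relative to $R\cup R'$ on $T$. Let $\mathcal{A}=(A,[\![\cdot]\!],\ge)$ be a monotone partial model for $R\cup R'\cup U$ with $T\subseteq\mathcal{L}(\mathcal{A})$, and let $\mathcal{B}=(B,[\![\cdot]\!]_{\mathcal{B}},\succ,\sqsupseteq)$ be an extended well-founded $\mu$-monotone $\mathrm{lab}_{\mathcal{A}}(\Sigma)$-algebra for the replacement map $\mu=\mu_{\mathcal{A}}^{R\cup R'}$, such that: (1) $(B,\succ)$ is a model for $\mathrm{lab}_{\mathcal{A}}(R')$; (2) $(B,\sqsupseteq)$ is a model for $\mathrm{lab}_{\mathcal{A}}(R)$; (3) for all $f\in\Sigma$, all $\vec a_1\,a\,\vec a_2\in A^{\mathrm{ar}(f)}$ with $[\![f]\!](\vec a_1,a,\vec a_2)$ defined, all $a'\in A$ with $a\ge a'$, and all $b_1,\dots,b_{\mathrm{ar}(f)}\in B$: $[\![f^{\vec a_1 a\vec a_2}]\!]_{\mathcal{B}}(b_1,\dots,b_{\mathrm{ar}(f)})\sqsupseteq[\![f^{\vec a_1 a'\vec a_2}]\!]_{\mathcal{B}}(b_1,\dots,b_{\mathrm{ar}(f)})$. Then $U\cup R'$ is terminating relative to $R$ on $T$.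
   Context: TRS: set of rules $\ell\to r$ ($\ell\notin\mathcal{X}$, $\mathrm{Var}(r)\subseteq\mathrm{Var}(\ell)$). For relations $\to_1,\to_2$, $\to_1$ is terminating relative to $\to_2$ on $B$ if $\to_2^*\cdot\to_1\cdot\to_2^*$ admits no infinite sequence starting in $B$; for TRSs use their rewrite relations. Partial $\Sigma$-algebra $(A,[\![\cdot]\!])$: partial $[\![f]\!]:A^n\rightharpoonup A$; $[\![x]\!]_\alpha=\alpha(x)$, $[\![f(t_1,..,t_n)]\!]_\alpha=[\![f]\!]([\![t_1]\!]_\alpha,\dots)$, defined only if all subexpressions are. $\mathcal{L}(\mathcal{A})$ is the set of ground terms $t$ with $[\![t]\!]$ defined. A monotone partial model $(A,[\![\cdot]\!],\ge)$ for a TRS $P$: every $[\![f]\!]$ is closed w.r.t. $\ge$ ($f(\dots,a,\dots)$ defined and $a\ge b$ imply $f(\dots,b,\dots)$ defined) and monotone w.r.t. $\ge$ (if both defined and $a\ge b$ then $f(\dots,a,\dots)\ge f(\dots,b,\dots)$), and for all $\ell\to r\in P$, $\alpha:\mathrm{Var}(\ell)\to A$ with $[\![\ell]\!]_\alpha$ defined, $[\![\ell]\!]_\alpha\ge[\![r]\!]_\alpha$. Labelling: $\mathrm{lab}_{\mathcal{A}}(\Sigma)=\{f^\lambda\mid f\in\Sigma,\lambda\in A^{\mathrm{ar}(f)},[\![f]\!](\lambda)\text{ defined}\}$; $\mathrm{lab}_\alpha(x)=x$, $\mathrm{lab}_\alpha(f(t_1,..,t_n))=f^{([\![t_1]\!]_\alpha,..,[\![t_n]\!]_\alpha)}(\mathrm{lab}_\alpha(t_1),..,\mathrm{lab}_\alpha(t_n))$;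 $\mathrm{lab}_{\mathcal{A}}(P)=\{\mathrm{lab}_\alpha(\ell)\to\mathrm{lab}_\alpha(r)\mid\ell\to r\in P,\ \alpha:\mathrm{Var}(\ell)\to A,\ [\![\ell]\!]_\alpha\text{ defined}\}$. Core $\mathrm{core}(\mathcal{A})$: smallest $C\subseteq A$ closed under defined applications of the $[\![f]\!]$. $N_{\mathcal{A}}^{P}$: largest $N\subseteq\mathrm{core}(\mathcal{A})$ with $[\![\ell]\!]_\alpha\notin N$ for all $\ell\to r\in P$, $\alpha:\mathrm{Var}(\ell)\to\mathrm{core}(\mathcal{A})$, and $[\![f]\!](a_1,..,a_n)\notin N$ whenever all $a_j\in\mathrm{core}(\mathcal{A})$ and some $a_i\notin N$. The replacement map $\mu_{\mathcal{A}}^{P}$ on $\mathrm{lab}_{\mathcal{A}}(\Sigma)$: for $f^{(a_1,..,a_n)}$, $\mu(f^{(a_1,..,a_n)})=\{1,..,n\}\setminus\{i\mid a_i\in N_{\mathcal{A}}^P\}$. For a signature $\Sigma'$ and replacement map $\mu$ (assigning each $f$ a subset of $\{1,..,\mathrm{ar}(f)\}$), an extended well-founded $\mu$-monotone $\Sigma'$-algebra $(B,[\![\cdot]\!]_{\mathcal{B}},\succ,\sqsupseteq)$ is a total $\Sigma'$-algebra with relations $\succ,\sqsupseteq$ on $B$ such that $\succ$ is terminating relative to $\sqsupseteq$ on $B$ and each $[\![f]\!]_{\mathcal{B}}$ is $\mu$-monotone w.r.t. $\succ$ and $\sqsupseteq$: for $i\in\mu(f)$ and $a\,\rho\,b$ ($\rho\in\{\succ,\sqsupseteq\}$),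 $f(\dots,a,\dots)\,\rho\,f(\dots,b,\dots)$ with $a,b$ at position $i$. $(B,\rho)$ is a model for a TRS $P'$ over $\Sigma'$ if $[\![\ell]\!]_\beta\,\rho\,[\![r]\!]_\beta$ for all $\ell\to r\in P'$ and all $\beta:\mathrm{Var}(\ell)\to B$. *)

(* Defs.v *)
From mathcomp Require Import all_boot.
From mathcomp Require Import boolp classical_sets.
From Stdlib Require Import Relation_Operators.

Set Implicit Arguments.
Unset Strict Implicit.
Unset Printing Implicit Defensive.

Local Open Scope classical_set_scope.

(* Vectors in [T ^ n] are functions ['I_n -> T]. *)
Definition upd (n : nat) (T : Type) (v : 'I_n -> T) (i : 'I_n) (x : T) :
    'I_n -> T :=
  fun j => if j == i then x else v j.

Record signature : Type := Signature { sym :> Type; ar : sym -> nat }.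

Inductive term (Sg : signature) (X : Type) : Type :=
| Var (x : X)
| App (f : Sg) (ts : 'I_(ar f) -> term Sg X).

Arguments Var {Sg X} x.
Arguments App {Sg X} f ts.

Section Terms.
Context {Sg : signature} {X : Type}.

Fixpoint vars (t : term Sg X) : set X :=
  match t with
  | Var x => [set x]
  | App f ts => \bigcup_i vars (ts i)
  end.

Definition ground_terms : set (term Sg X) := [set t | vars t = set0].

Fixpoint subst (s : X -> term Sg X) (t : term Sg X) : term Sg X :=
  match t with
  | Var x => s x
  | App f ts => App f (fun i => subst s (ts i))
  end.

Definition is_trs (P : set (term Sg X * term Sg X)) : Prop :=
  forall l r, P (l, r) -> (forall x, l <> Var x) /\ vars r `<=` vars l.

Inductive rewrite (P : set (term Sg X * term Sg X)) :
    term Sg X -> term Sg X -> Prop :=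
| rewrite_root l r s : P (l, r) -> rewrite P (subst s l) (subst s r)
| rewrite_arg (f : Sg) ts i t u :
    rewrite P t u -> rewrite P (App f (upd ts i t)) (App f (upd ts i u)).

End Terms.

Definition relative_step (T : Type) (r1 r2 : T -> T -> Prop) (x y : T) : Prop :=
  exists x' y', [/\ clos_refl_trans T r2 x x', r1 x' y'
                  & clos_refl_trans T r2 y' y].

Definition terminating_relative (T : Type) (r1 r2 : T -> T -> Prop)
    (D : set T) : Prop :=
  ~ exists s : nat -> T,
      D (s 0) /\ forall n, relative_step r1 r2 (s n) (s n.+1).

Record partial_algebra (Sg : signature) : Type := PartialAlgebra {
  pcarrier :> Type;
  pint : forall f : Sg, ('I_(ar f) -> pcarrier) -> option pcarrier }.

Arguments pint {Sg} p f v.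

Section PartialAlgebra.
Context {Sg : signature} {X : Type} (A : partial_algebra Sg).

(* [evaluates al t a] is the graph of the partial map t |-> [[t]]_al, i.e.
   "[[t]]_al is defined and equal to a".  Assignments Var(l) -> A are
   represented by partial maps X -> option A: if [[l]]_al is defined then al is
   defined on all of Var(l), and the value depends only on al restricted to
   Var(l). *)
Inductive evaluates (al : X -> option A) : term Sg X -> A -> Prop :=
| evaluates_var x a : al x = Some a -> evaluates al (Var x) a
| evaluates_app (f : Sg) ts (v : 'I_(ar f) -> A) a :
    (forall i, evaluates al (ts i) (v i)) -> pint A f v = Some a ->
    evaluates al (App f ts) a.

Lemma evaluates_inv al t a : evaluates al t a ->
  match t with
  | Var x => al x = Some a
  | App f ts => exists v, (forall i, evaluates al (ts i) (v i)) /\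
                          pint A f v = Some a
  end.
Proof. by case=> // f ts v b ev fv; exists v. Qed.

Lemma evaluates_functional al t a b :
  evaluates al t a -> evaluates al t b -> a = b.
Proof.
move=> ev; elim: ev b => {t a} [x a alx|f ts v a _ IH fva] b /evaluates_inv.
  by rewrite alx => -[].
move=> [w [evw fwb]]; have vw : v = w by apply/funext => i; exact: IH.
by move: fwb; rewrite -vw fva => -[].
Qed.

Definition language : set (term Sg X) :=
  [set t | ground_terms t /\ exists a, evaluates (fun=> None) t a].

Definition closed_wrt (ge : A -> A -> Prop) : Prop :=
  forall (f : Sg) v i a b,
    pint A f (upd v i a) -> ge a b -> pint A f (upd v i b).

Definition monotone_wrt (ge : A -> A -> Prop) : Prop :=
  forall (f : Sg) v i a b c d,
    pint A f (upd v i a) = Some c -> pint A f (upd v i b) = Some d ->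
    ge a b -> ge c d.

Definition monotone_partial_model (ge : A -> A -> Prop)
    (P : set (term Sg X * term Sg X)) : Prop :=
  [/\ closed_wrt ge, monotone_wrt ge &
      forall l r al a, P (l, r) -> evaluates al l a ->
        exists b, evaluates al r b /\ ge a b].

Inductive core : set A :=
| core_app (f : Sg) (v : 'I_(ar f) -> A) a :
    (forall i, core (v i)) -> pint A f v = Some a -> core a.

Definition nf_admissible (P : set (term Sg X * term Sg X)) (N : set A) : Prop :=
  [/\ N `<=` core,
      forall l r al a, P (l, r) -> (forall x b, al x = Some b -> core b) ->
        evaluates al l a -> ~ N a
    & forall (f : Sg) (v : 'I_(ar f) -> A) a,
        (forall j, core (v j)) -> (exists i, ~ N (v i)) ->
        pint A f v = Some a -> ~ N a].

(* The largest admissible set exists, see [nf_valuesP]. *)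
Definition nf_values (P : set (term Sg X * term Sg X)) : set A :=
  \bigcup_(N in nf_admissible P) N.

Lemma nf_valuesP (P : set (term Sg X * term Sg X)) :
  nf_admissible P (nf_values P) /\
  forall N, nf_admissible P N -> N `<=` nf_values P.
Proof.
split; last by move=> N hN a Na; exists N.
split.
- by move=> a [N [hN _ _]] /hN.
- by move=> l r al a Plr hal ev [N [_ hN _] /=]; exact: hN Plr hal ev.
- move=> f v a cv [i nNi] fa [N hN Na]; case: (hN) => _ _ /(_ f v a cv).
  by apply=> //; exists i => Ni; apply: nNi; exists N.
Qed.

End PartialAlgebra.

Arguments language {Sg} X A.

Record lab_sym (Sg : signature) (A : partial_algebra Sg) : Type := LabSym {
  lab_base : Sg;
  lab_label : 'I_(ar lab_base) -> A;
  lab_defined : pint A lab_base lab_label }.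

Arguments LabSym {Sg A} lab_base lab_label lab_defined.
Arguments lab_label {Sg A} l.

Definition lab_sig (Sg : signature) (A : partial_algebra Sg) : signature :=
  Signature (fun fl : lab_sym A => ar (lab_base fl)).

Section Labelling.
Context {Sg : signature} {X : Type} (A : partial_algebra Sg).

(* Graph of the partial map lab_al. *)
Inductive labels (al : X -> option A) :
    term Sg X -> term (lab_sig A) X -> Prop :=
| labels_var x : labels al (Var x) (Var x)
| labels_app (f : Sg) ts (v : 'I_(ar f) -> A) (d : pint A f v)
    (us : 'I_(ar f) -> term (lab_sig A) X) :
    (forall i, evaluates al (ts i) (v i)) ->
    (forall i, labels al (ts i) (us i)) ->
    labels al (App f ts) (App (LabSym f v d : lab_sig A) us).

Definition lab_rules (P : set (term Sg X * term Sg X)) :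
    set (term (lab_sig A) X * term (lab_sig A) X) :=
  [set p | exists l r al a,
     [/\ P (l, r), evaluates al l a, labels al l p.1 & labels al r p.2]].

End Labelling.

Arguments lab_rules {Sg X} A P _.

Definition replacement_map (Sg : signature) : Type :=
  forall f : Sg, set 'I_(ar f).

Definition lab_mu (Sg : signature) (X : Type) (A : partial_algebra Sg)
    (P : set (term Sg X * term Sg X)) : replacement_map (lab_sig A) :=
  fun fl => ~` [set i | nf_values P (lab_label fl i)].

Arguments lab_mu {Sg X} A P f.

Record algebra (Sg : signature) : Type := Algebra {
  carrier :> Type;
  aint : forall f : Sg, ('I_(ar f) -> carrier) -> carrier }.

Arguments aint {Sg} a f v.

Section TotalAlgebra.
Context {Sg : signature} {X : Type} (B : algebra Sg).

Fixpoint eval (be : X -> B) (t : term Sg X) : B :=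
  match t with
  | Var x => be x
  | App f ts => aint B f (fun i => eval be (ts i))
  end.

Definition mu_monotone (mu : replacement_map Sg) (rho : B -> B -> Prop) : Prop :=
  forall (f : Sg) v i a b, mu f i -> rho a b ->
    rho (aint B f (upd v i a)) (aint B f (upd v i b)).

Definition ext_wf_mu_monotone (mu : replacement_map Sg)
    (gt sq : B -> B -> Prop) : Prop :=
  [/\ terminating_relative gt sq setT, mu_monotone mu gt & mu_monotone mu sq].

Definition model (rho : B -> B -> Prop) (P : set (term Sg X * term Sg X)) : Prop :=
  forall l r be, P (l, r) -> rho (eval be l) (eval be r).

End TotalAlgebra.

(* Main.v *)
(** Every ground term [t] of the language gets a value [a] in [A] and, through
    its labelling, a value [b] in [B].  A step at the root is a step of the
    labelled system.  A step below the root happens inside a reducible subterm,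
    whose value is therefore outside [nf_values]; so the labelled symbol above
    it is monotone at that position, and the decrease of the label that may
    result costs only [sq]-steps, by condition (3).  Hence [R']-steps decrease
    [b] by [gt] modulo [sq] and [R]-steps by [sq] alone.  The theorem follows by
    well-founded induction on the lexicographic combination of [U] relative to
    [R `|` R'] and of [gt] relative to [sq]. *)
Require Import Defs.
From mathcomp Require Import all_boot.
From mathcomp Require Import boolp classical_sets.

From Stdlib Require Import Relation_Operators.

Local Open Scope classical_set_scope.

(** * Relative termination as accessibility *)

Section Relations.
Set Implicit Arguments.
Unset Strict Implicit.
Context {T : Type}.
Implicit Types (r s : T -> T -> Prop) (D : set T).

Lemma clos_rt_mono r s x y : (forall x y, r x y -> s x y) ->
  clos_refl_trans T r x y -> clos_refl_trans T s x y.
Proof.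
move=> rs; elim=> {x y} [x y /rs|x|x y z _ xy _ yz]; first exact: rt_step.
  exact: rt_refl.
exact: rt_trans xy yz.
Qed.

(** Turns the absence of infinite sequences into a principle of well-founded induction. Classically,
    a point that is not accessible has a successor that is not accessible either, and iterating a
    choice of successors builds an infinite sequence. *)
Lemma terminating_relativeP r s D :
  terminating_relative r s D <->
  forall x, D x -> Acc (fun y x => relative_step r s x y) x.
Proof.
split=> [term x Dx|acc [u [Du uS]]].
  apply: contrapT => nacc; apply: term.
  pose nAcc := {y | ~ Acc (fun y x => relative_step r s x y) y}.
  have next (p : nAcc) : {q : nAcc | relative_step r s (sval p) (sval q)}.
    case: p => y nacc_y /=; apply: cid; apply: contrapT => nq.
    apply: nacc_y; constructor=> z yz; apply: contrapT => nacc_z.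
    by apply: nq; exists (exist _ z nacc_z).
  exists (fun n => sval (iter n (fun p => sval (next p)) (exist _ x nacc))).
  by split=> // n /=; exact: svalP (next _).
suff nacc x : Acc (fun y x => relative_step r s x y) x -> forall n, u n <> x.
  exact: nacc (acc _ Du) 0 erefl.
elim=> {}x _ IH n ux; apply: (IH (u n.+1)) erefl; rewrite -ux; exact: uS.
Qed.

End Relations.

Section Rewriting.
Set Implicit Arguments.
Unset Strict Implicit.
Context {Sg : signature} {X : Type}.
Implicit Types P Q : set (term Sg X * term Sg X).

Lemma rewrite_mono P Q t u : P `<=` Q -> rewrite P t u -> rewrite Q t u.
Proof.
move=> PQ; elim=> {t u} [l r s /PQ|f ts i t u _]; first exact: rewrite_root.
exact: rewrite_arg.
Qed.

Lemma rewriteU P Q t u :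
  rewrite (P `|` Q) t u -> rewrite P t u \/ rewrite Q t u.
Proof.
elim=> {t u} [l r s [Plr|Qlr]|f ts i t u _ [tu|tu]].
- by left; exact: rewrite_root.
- by right; exact: rewrite_root.
- by left; exact: rewrite_arg.
- by right; exact: rewrite_arg.
Qed.

End Rewriting.

Section Update.
Set Implicit Arguments.
Unset Strict Implicit.

Lemma upd_id n (T : Type) (v : 'I_n -> T) i : upd v i (v i) = v.
Proof. by apply/funext => j; rewrite /upd; case: eqP => [->|]. Qed.

Lemma upd_same n (T : Type) (v : 'I_n -> T) i x : upd v i x i = x.
Proof. by rewrite /upd eqxx. Qed.

End Update.

(** * Values of ground terms in [A] and [B] *)

Section Values.
Set Implicit Arguments.
Unset Strict Implicit.
Context {Sg : signature} {X : Type} {A : partial_algebra Sg}.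
Context {B : algebra (lab_sig A)}.
Implicit Types (t u : term Sg X) (P Q : set (term Sg X * term Sg X)).
Implicit Types (a : A) (b : B).

(* [lab_value t a b]: the ground term [t] evaluates to [a] in [A], and its
   labelling evaluates to [b] in [B]. *)
Inductive lab_value : term Sg X -> A -> B -> Prop :=
| lab_value_app (f : Sg) ts v bs (d : pint A f v) a :
    (forall i, lab_value (ts i) (v i) (bs i)) -> pint A f v = Some a ->
    lab_value (App f ts) a (aint B (LabSym f v d) bs).

Lemma lab_value_inv t a b : lab_value t a b ->
  match t with
  | Var x => False
  | App f ts => exists v bs (d : pint A f v),
      [/\ forall i, lab_value (ts i) (v i) (bs i), pint A f v = Some a
        & b = aint B (LabSym f v d) bs]
  end.
Proof. by case=> f ts v bs d {}a tv fv; exists v, bs, d. Qed.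

Lemma lab_value_functional t a b a' b' :
  lab_value t a b -> lab_value t a' b' -> a = a' /\ b = b'.
Proof.
move=> val; elim: val a' b' => {t a b} f ts v bs d a _ IH fv a' b'.
move=> /lab_value_inv [w [cs [e [tw fw ->]]]].
have vw : v = w by apply/funext => i; case: (IH i _ _ (tw i)).
have bc : bs = cs by apply/funext => i; case: (IH i _ _ (tw i)).
rewrite -{}bc {IH tw}; case: _ / vw e fw => e; rewrite fv => -[->].
(* The labelled symbols can now differ only in their proofs of definedness, which are proofs of a
   boolean. *)
by rewrite (bool_irrelevance d e).
Qed.

Lemma lab_value_core t a b : lab_value t a b -> core a.
Proof. by elim=> {t a b} f ts v bs d a _ cv; exact: core_app. Qed.

Lemma evaluates_lab_value t a :
  evaluates (fun=> None) t a -> exists b, lab_value t a b.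
Proof.
elim=> {t a} [//|f ts v a _ /choice[bs tv] fv].
have d : pint A f v by rewrite fv.
by exists (aint B (LabSym f v d) bs); exact: lab_value_app.
Qed.

Section Substitution.
Variables (s : X -> term Sg X) (al : X -> option A) (be : X -> B).
Hypothesis s_al : forall x a, al x = Some a -> lab_value (s x) a (be x).

(** Labelling commutes with substitution, so an instance of a rule takes the values of the labelled
    rule under [be]. *)
Lemma evaluates_subst t a : evaluates al t a ->
  exists2 t', labels al t t' & lab_value (subst s t) a (eval be t').
Proof.
elim=> {t a} [x a alx|f ts v a ev IH fv].
  by exists (Var x); [exact: labels_var|exact: s_al].
have /choice[us tus] i : exists t' : term (lab_sig A) X,
    labels al (ts i) t' /\ lab_value (subst s (ts i)) (v i) (eval be t').
  by have [t' lt vt] := IH i; exists t'.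
have d : pint A f v by rewrite fv.
exists (App (LabSym f v d : lab_sig A) us).
  by apply: labels_app => // i; case: (tus i).
by apply: lab_value_app => // i; case: (tus i).
Qed.

End Substitution.

(** Choice collects the values of all [s x] into [al] and [be]; [al] is defined on the variables of
    [t] because subterms of a term with a value have values. *)
Lemma lab_value_subst s t a b : lab_value (subst s t) a b ->
  exists al be, (forall x a, al x = Some a -> lab_value (s x) a (be x)) /\
    evaluates al t a.
Proof.
move=> val.
have /choice[h hP] (x : X) : exists p : option A * B,
    (forall a, p.1 = Some a -> lab_value (s x) a p.2) /\
    (forall a b, lab_value (s x) a b -> p.1 = Some a).
  have [[c [e sx]]|nsx] := EM (exists c e, lab_value (s x) c e).
    exists (Some c, e); split=> /= [_ [<-] //|c' e' sx'].
    by have [->] := lab_value_functional sx sx'.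
  (* Where [s x] has no value, [b] is a filler that keeps [be] total. *)
  by exists (None, b); split=> //= c e sx; case: nsx; exists c, e.
exists (fun x => (h x).1), (fun x => (h x).2).
split=> [x|]; first by case: (hP x).
elim: t a b val => [x|f ts IH] a b /= val.
  by apply: evaluates_var; case: (hP x) => _; apply; exact: val.
have [v [bs [d [tv fv _]]]] := lab_value_inv val.
by apply: (evaluates_app (v := v)) => // i; exact: IH (tv i).
Qed.

(** * Effect of rewrite steps on values *)

Lemma monotone_partial_model_sub (ge : A -> A -> Prop) P Q :
  P `<=` Q -> monotone_partial_model ge Q -> monotone_partial_model ge P.
Proof. by move=> PQ [? ? mod]; split=> // l r al a /PQ; exact: mod. Qed.

(** At the root this is the model condition; below it, closedness keeps the value defined and
    monotonicity carries [ge] upwards. *)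
Lemma lab_value_rewrite ge P t u a b : monotone_partial_model ge P ->
  rewrite P t u -> lab_value t a b ->
  exists a' b', lab_value u a' b' /\ ge a a'.
Proof.
move=> [clos mono mod] tu.
elim: tu a b => {t u} [l r s Plr|f ts i t u _ IH] a b.
  move=> /lab_value_subst[al [be [s_al]]] /(mod _ _ _ _ Plr) [a' [evr aa']].
  by have [r' _ vr] := evaluates_subst s_al evr; exists a', (eval be r').
move=> /lab_value_inv [v [bs [d [tv fv _]]]].
move: (tv i); rewrite upd_same => /IH [a' [b' [ua' va']]].
have d' : pint A f (upd v i a') by apply: clos va'; rewrite upd_id.
case fc : (pint A f (upd v i a')) (d') => [c|//] _.
exists c, (aint B (LabSym f (upd v i a') d') (upd bs i b')); split.
  apply: lab_value_app => // j; rewrite /upd; case: eqP => [//|ji].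
  by move: (tv j); rewrite /upd; case: eqP.
by apply: mono fc va'; rewrite upd_id fv.
Qed.

(** The second clause of [nf_admissible] excludes the values of redexes, and the third passes the
    exclusion on to every surrounding context. Both clauses apply since values of ground terms lie
    in [core]. *)
Lemma rewrite_nf_values P t u a b :
  rewrite P t u -> lab_value t a b -> ~ nf_values P a.
Proof.
have [[_ redex arg] _] := nf_valuesP A P.
move=> tu; elim: tu a b => {t u} [l r s Plr|f ts i t u _ IH] a b.
  move=> /lab_value_subst[al [be [s_al ev]]].
  by apply: redex Plr _ ev => x c /s_al /lab_value_core.
move=> /lab_value_inv [v [bs [d [tv fv _]]]].
apply: arg fv => [j|]; first exact: lab_value_core (tv j).
by exists i; move: (tv i); rewrite upd_same => /IH.
Qed.

Lemma mu_monotone_clos_rt (mu : replacement_map (lab_sig A))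
    (sq : B -> B -> Prop) :
  mu_monotone mu sq -> mu_monotone mu (clos_refl_trans B sq).
Proof.
move=> mono f v i a b mui; elim=> {a b} [a b ab|a|a b c _ ab _ bc].
- by apply: rt_step; exact: mono.
- exact: rt_refl.
- exact: rt_trans ab bc.
Qed.

(** Stated for any [rho] so as to serve both [R] (with [sq]) and [R'] (with [gt]). The trailing
    [sq]-steps absorb one change of label per level of context. *)
Lemma lab_value_rewrite_mono ge (sq rho : B -> B -> Prop) P Q t u a b a' b' :
  P `<=` Q -> monotone_partial_model ge P ->
  mu_monotone (lab_mu A Q) sq -> mu_monotone (lab_mu A Q) rho ->
  model rho (lab_rules A P) ->
  (forall (f : Sg) (v : 'I_(ar f) -> A) i a a'
     (d : pint A f (upd v i a)) (d' : pint A f (upd v i a')) bs,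
     ge a a' -> sq (aint B (LabSym f (upd v i a) d) bs)
                   (aint B (LabSym f (upd v i a') d') bs)) ->
  rewrite P t u -> lab_value t a b -> lab_value u a' b' ->
  exists2 c, rho b c & clos_refl_trans B sq c b'.
Proof.
move=> PQ modP sq_mono rho_mono modrho h3 tu.
elim: tu a b a' b' => {t u} [l r s Plr|f ts i t u tu IH] a b a' b' vt vu.
  have [al [be [s_al evl]]] := lab_value_subst vt.
  have [_ _ /(_ _ _ _ _ Plr evl)[c [evr _]]] := modP.
  have [l' ll vl] := evaluates_subst s_al evl.
  have [r' lr vr] := evaluates_subst s_al evr.
  have [_ ->] := lab_value_functional vt vl.
  have [_ ->] := lab_value_functional vu vr.
  exists (eval be r'); last exact: rt_refl.
  by apply: modrho; exists l, r, al, a.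
have [v [bs [d [tv fv bE]]]] := lab_value_inv vt.
have vti : lab_value t (v i) (bs i) by move: (tv i); rewrite upd_same.
have [c [e [vui vic]]] := lab_value_rewrite modP tu vti.
have [e' rho_e' e'e] := IH _ _ _ _ vti vui.
have mui : lab_mu A Q (LabSym f v d) i.
  by have := rewrite_nf_values (rewrite_mono PQ tu) vti.
have d' : pint A f (upd v i c).
  by have [clos _ _] := modP; apply: clos vic; rewrite upd_id.
have b'E : b' = aint B (LabSym f (upd v i c) d') (upd bs i e).
  have [x fc] : exists x, pint A f (upd v i c) = Some x.
    by move: (d'); case: (pint A f _) => // x _; exists x.
  suff /(lab_value_functional vu)[] : lab_value (App f (upd ts i u)) x
    (aint B (LabSym f (upd v i c) d') (upd bs i e)) by [].
  apply: lab_value_app => // j; rewrite /upd; case: eqP => [//|ji].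
  by move: (tv j); rewrite /upd; case: eqP.
(* Rewrite the argument under the old label first: [rho] and then the [sq]-steps lift through
   position [i]. Only the last step changes the label. *)
exists (aint B (LabSym f v d) (upd bs i e')).
  by rewrite bE -{1}[bs](upd_id bs i); exact: rho_mono.
apply: (@rt_trans _ _ _ (aint B (LabSym f v d) (upd bs i e))).
  exact: (mu_monotone_clos_rt sq_mono).
apply: rt_step; rewrite b'E.
have := h3 f v i (v i) c; rewrite upd_id => /(_ d d'); exact.
Qed.

End Values.

Theorem theorem9p5 (Sg : signature) (X : Type)
    (R R' U : set (term Sg X * term Sg X))
    (hR : is_trs R) (hR' : is_trs R') (hU : is_trs U)
    (T : set (term Sg X)) (hT : T `<=` ground_terms)
    (hterm : terminating_relative (rewrite U) (rewrite (R `|` R')) T)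
    (A : partial_algebra Sg) (ge : A -> A -> Prop)
    (hA : monotone_partial_model ge (R `|` R' `|` U))
    (hTA : T `<=` language X A)
    (B : algebra (lab_sig A)) (gt sq : B -> B -> Prop)
    (hB : ext_wf_mu_monotone (lab_mu A (R `|` R')) gt sq)
    (h1 : model gt (lab_rules A R'))
    (h2 : model sq (lab_rules A R))
    (h3 : forall (f : Sg) (v : 'I_(ar f) -> A) (i : 'I_(ar f)) (a a' : A)
            (d : pint A f (upd v i a)) (d' : pint A f (upd v i a'))
            (b : 'I_(ar f) -> B),
        ge a a' ->
        sq (aint B (LabSym f (upd v i a) d) b)
           (aint B (LabSym f (upd v i a') d') b)) :
  terminating_relative (rewrite (U `|` R')) (rewrite R) T.
Proof.
have [/terminating_relativeP accB gt_mono sq_mono] := hB.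
have subR : R `<=` R `|` R' by move=> p; left.
have subR' : R' `<=` R `|` R' by move=> p; right.
have modR : monotone_partial_model ge R.
  by apply: monotone_partial_model_sub hA => p; left; left.
have modR' : monotone_partial_model ge R'.
  by apply: monotone_partial_model_sub hA => p; left; right.
have modU : monotone_partial_model ge U.
  by apply: monotone_partial_model_sub hA => p; right.
have rtR t u :=
  @clos_rt_mono _ _ _ t u (fun x y => @rewrite_mono _ _ _ _ x y subR).
have stepsR t u : clos_refl_trans _ (rewrite R) t u ->
    forall a (b : B), lab_value t a b ->
    exists a' b', lab_value u a' b' /\ clos_refl_trans B sq b b'.
  elim=> {t u} [t u tu|t|t u w _ IHtu _ IHuw] a b vt.
  - have [a' [b' [vu _]]] := lab_value_rewrite modR tu vt.
    exists a', b'; split=> //.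
    have [c bc cb'] := lab_value_rewrite_mono subR modR sq_mono sq_mono h2 h3
      tu vt vu.
    by apply: rt_trans cb'; exact: rt_step.
  - by exists a, b; split=> //; exact: rt_refl.
  - have [a' [b' [/IHuw[a'' [b'' [vw b'b'']]] bb']]] := IHtu _ _ vt.
    by exists a'', b''; split=> //; exact: rt_trans bb' b'b''.
apply/terminating_relativeP => t Tt.
have [_ [a /(@evaluates_lab_value _ _ _ B) [b vt]]] := hTA _ Tt.
move: hterm => /terminating_relativeP /(_ t Tt) accU.
(* The outer induction needs an anchor [t] that stays fixed during [R]- and [R']-steps, while the
   current term [u] moves among its reducts. *)
suff main u : clos_refl_trans _ (rewrite (R `|` R')) t u ->
    forall a (b : B), lab_value u a b ->
    Acc (fun y x => relative_step (rewrite (U `|` R')) (rewrite R) x y) u.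
  exact: main (rt_refl _ _ _) _ _ vt.
elim: accU u {Tt a b vt} => {}t _ IHt u tu a b.
elim: {b}(accB b I) u tu a => b _ IHb u tu a vu.
constructor=> w [x [y [ux xy yw]]].
have [ax [bx [vx bbx]]] := stepsR _ _ ux _ _ vu.
have tx := rt_trans _ _ _ _ _ tu (rtR _ _ ux).
case: (rewriteU xy) => {}xy.
  (* A [U]-step may change the value in [B] arbitrarily, but it makes [w] a relative successor of
     [t], so [w] becomes the new anchor. *)
  have [ay [b_y [vy _]]] := lab_value_rewrite modU xy vx.
  have [aw [bw [vw _]]] := stepsR _ _ yw _ _ vy.
  apply: IHt (rt_refl _ _ _) _ _ vw.
  by exists x, y; split=> //; exact: rtR.
(* An [R']-step keeps the anchor [t] and yields a relative [gt]-step from [b] to [bw]. *)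
have [ay [b_y [vy _]]] := lab_value_rewrite modR' xy vx.
have [aw [bw [vw byw]]] := stepsR _ _ yw _ _ vy.
have [c bxc cby] := lab_value_rewrite_mono subR' modR' sq_mono gt_mono h1 h3
  xy vx vy.
apply: IHb _ _ vw.
  by exists bx, c; split=> //; exact: rt_trans cby byw.
apply: rt_trans tx _; apply: rt_trans (rtR _ _ yw).
by apply: rt_step; exact: rewrite_mono xy.
Qed.
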